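(* For every $\Gamma\cup\{\phi\}\subseteq\mathcal{L}_{\triangledown}$: (1) $\Gamma\vdash_{\mathsf{iM}}\phi$ if and only if $\Gamma^{\Diamond}\vdash_{\mathsf{WM}}\phi^{\Diamond}$; (2) $\Gamma\vdash_{\mathsf{iM}}\phi$ implies $\Gamma^{\Diamond}\vdash_{\mathsf{IM}}\phi^{\Diamond}$; and the implication in (2) is strict, i.e. there exist $\Gamma,\phi$ with $\Gamma^{\Diamond}\vdash_{\mathsf{IM}}\phi^{\Diamond}$ but $\Gamma\not\vdash_{\mathsf{iM}}\phi$.
   Context: $\mathcal{L}_{\triangledown}$: formulas $\phi ::= p_i \mid \bot \mid \phi\wedge\phi \mid \phi\vee\phi \mid \phi\to\phi \mid \triangledown\phi$; $\mathcal{L}_{\Box\Diamond}$: formulas $\phi ::= p_i \mid \bot \mid \phi\wedge\phi \mid \phi\vee\phi \mid \phi\to\phi \mid \Box\phi\mid\Diamond\phi$, over the same countable set of proposition letters; $\neg\phi:=\phi\to\bot$, $\top:=\neg\bot$. For $\phi\in\mathcal{L}_{\triangledown}$, $\phi^{\Diamond}\in\mathcal{L}_{\Box\Diamond}$ replaces every $\triangledown$ by $\Diamond$; $\Gamma^{\Diamond}=\{\psi^{\Diamond}\mid\psi\in\Gamma\}$. Generalised Hilbert calculi: given a set $\mathscr{Ax}$ of formulas (always including all substitution instances of a standard axiomatisation of intuitionistic propositional logic), derivable consecutions $\Gamma\vdash\phi$ are generated by (El) $\Gamma\vdash\phi$ for $\phi\in\Gamma$; (Ax) $\Gamma\vdash\psi$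 for $\psi\in\mathscr{Ax}$; (MP) from $\Gamma\vdash\phi$ and $\Gamma\vdash\phi\to\psi$ infer $\Gamma\vdash\psi$; and for each modality $\heartsuit$ of the language, (Mon$_\heartsuit$) from $\emptyset\vdash\phi\to\psi$ infer $\Gamma\vdash\heartsuit\phi\to\heartsuit\psi$ (any $\Gamma$). $\mathsf{iM}$: language $\mathcal{L}_{\triangledown}$, no extra axioms. $\mathsf{WM}$: language $\mathcal{L}_{\Box\Diamond}$, extra axioms all substitution instances of $(\Box p\wedge\Diamond\neg p)\to\bot$. $\mathsf{IM}$: language $\mathcal{L}_{\Box\Diamond}$, extra axioms all substitution instances of $(\Box p\wedge\Diamond\neg p)\to\bot$ and $(\Box\top\to\Diamond p)\to\Diamond p$. *)

(* Defs.v *)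
From Stdlib Require Export Ensembles Image.

(* Formulas over the letters [p_0, p_1, ...], with one unary connective for
   each element of [M]. *)
Inductive form (M : Type) : Type :=
| Var (i : nat)
| Bot
| And (phi psi : form M)
| Or (phi psi : form M)
| Imp (phi psi : form M)
| Mod (m : M) (phi : form M).

Arguments Var {M} i.
Arguments Bot {M}.
Arguments And {M} phi psi.
Arguments Or {M} phi psi.
Arguments Imp {M} phi psi.
Arguments Mod {M} m phi.

Definition Neg {M : Type} (phi : form M) : form M := Imp phi Bot.
Definition Top {M : Type} : form M := Neg Bot.

Fixpoint subst {M : Type} (s : nat -> form M) (phi : form M) : form M :=
  match phi with
  | Var i => s i
  | Bot => Bot
  | And a b => And (subst s a) (subst s b)
  | Or a b => Or (subst s a) (subst s b)
  | Imp a b => Imp (subst s a) (subst s b)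
  | Mod m a => Mod m (subst s a)
  end.

Definition instances {M : Type} (A : Ensemble (form M)) : Ensemble (form M) :=
  fun psi => exists (s : nat -> form M) (a : form M),
    In _ A a /\ psi = subst s a.

Inductive ipc_axiom {M : Type} : Ensemble (form M) :=
| ipc_K : ipc_axiom (Imp (Var 0) (Imp (Var 1) (Var 0)))
| ipc_S : ipc_axiom (Imp (Imp (Var 0) (Imp (Var 1) (Var 2)))
                         (Imp (Imp (Var 0) (Var 1)) (Imp (Var 0) (Var 2))))
| ipc_andI : ipc_axiom (Imp (Var 0) (Imp (Var 1) (And (Var 0) (Var 1))))
| ipc_andE1 : ipc_axiom (Imp (And (Var 0) (Var 1)) (Var 0))
| ipc_andE2 : ipc_axiom (Imp (And (Var 0) (Var 1)) (Var 1))
| ipc_orI1 : ipc_axiom (Imp (Var 0) (Or (Var 0) (Var 1)))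
| ipc_orI2 : ipc_axiom (Imp (Var 1) (Or (Var 0) (Var 1)))
| ipc_orE : ipc_axiom (Imp (Imp (Var 0) (Var 2))
                           (Imp (Imp (Var 1) (Var 2))
                                (Imp (Or (Var 0) (Var 1)) (Var 2))))
| ipc_botE : ipc_axiom (Imp Bot (Var 0)).

Inductive derives {M : Type} (Ax : Ensemble (form M)) :
  Ensemble (form M) -> form M -> Prop :=
| D_El (Gamma : Ensemble (form M)) (phi : form M) :
    In _ Gamma phi -> derives Ax Gamma phi
| D_Ax (Gamma : Ensemble (form M)) (psi : form M) :
    In _ Ax psi -> derives Ax Gamma psi
| D_MP (Gamma : Ensemble (form M)) (phi psi : form M) :
    derives Ax Gamma phi -> derives Ax Gamma (Imp phi psi) ->
    derives Ax Gamma psi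
| D_Mon (m : M) (Gamma : Ensemble (form M)) (phi psi : form M) :
    derives Ax (Empty_set _) (Imp phi psi) ->
    derives Ax Gamma (Imp (Mod m phi) (Mod m psi)).

(* The calculus over all substitution instances of the intuitionistic axioms
   and of the additional axioms [extra]. *)
Definition calculus {M : Type} (extra : Ensemble (form M)) :
  Ensemble (form M) -> form M -> Prop :=
  derives (instances (Union _ ipc_axiom extra)).

Inductive tri_modality : Set := tri.
Inductive boxdia_modality : Set := box | dia.

Definition L_tri : Type := form tri_modality.
Definition L_boxdia : Type := form boxdia_modality.

Fixpoint tr_dia (phi : L_tri) : L_boxdia :=
  match phi with
  | Var i => Var i
  | Bot => Bot
  | And a b => And (tr_dia a) (tr_dia b)
  | Or a b => Or (tr_dia a) (tr_dia b)
  | Imp a b => Imp (tr_dia a) (tr_dia b)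
  | Mod tri a => Mod dia (tr_dia a)
  end.

Definition set_dia (Gamma : Ensemble L_tri) : Ensemble L_boxdia :=
  Im _ _ Gamma tr_dia.

(* (Box p /\ Dia ~p) -> Bot *)
Definition ax_box_dia_neg : L_boxdia :=
  Imp (And (Mod box (Var 0)) (Mod dia (Neg (Var 0)))) Bot.

(* (Box Top -> Dia p) -> Dia p *)
Definition ax_box_top_dia : L_boxdia :=
  Imp (Imp (Mod box Top) (Mod dia (Var 0))) (Mod dia (Var 0)).

Definition derives_iM : Ensemble L_tri -> L_tri -> Prop :=
  calculus (Empty_set _).

Definition derives_WM : Ensemble L_boxdia -> L_boxdia -> Prop :=
  calculus (Singleton _ ax_box_dia_neg).

Definition derives_IM : Ensemble L_boxdia -> L_boxdia -> Prop :=
  calculus (Couple _ ax_box_dia_neg ax_box_top_dia).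

(* Main.v *)
(** Reading [Dia] as [tri] and every [Box phi] as [Bot] turns a WM-derivation
    into an iM-derivation, since the axiom becomes an instance of
    [Bot /\ q -> Bot]; this reading undoes the diamond translation, so WM is
    conservative over iM.  In IM, [~~Dia Bot] refutes [Box Top], so the second
    axiom yields [Dia Bot].  In iM, [~~tri Bot] does not entail [tri Bot]: take
    the three-element Heyting chain with [tri] constantly the middle element. *)

Require Import Defs.

Definition inst3 {M : Type} (a b c : form M) (i : nat) : form M :=
  match i with 0 => a | 1 => b | _ => c end.

Section Calculus.
Context {M : Type} (extra : Ensemble (form M)).
Implicit Types (Gamma Delta : Ensemble (form M)) (a b c : form M).

Lemma calculus_ipc Gamma s a :
  In _ ipc_axiom a -> calculus extra Gamma (subst s a).
Proof.
  intros Ha. apply D_Ax. exists s, a. split; [left; exact Ha | reflexivity].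
Qed.

Lemma calculus_extra Gamma s a :
  In _ extra a -> calculus extra Gamma (subst s a).
Proof.
  intros Ha. apply D_Ax. exists s, a. split; [right; exact Ha | reflexivity].
Qed.

Lemma calculus_K Gamma a b : calculus extra Gamma (Imp a (Imp b a)).
Proof. exact (calculus_ipc Gamma (inst3 a b b) _ ipc_K). Qed.

Lemma calculus_S Gamma a b c :
  calculus extra Gamma
    (Imp (Imp a (Imp b c)) (Imp (Imp a b) (Imp a c))).
Proof. exact (calculus_ipc Gamma (inst3 a b c) _ ipc_S). Qed.

Lemma calculus_andE1 Gamma a b : calculus extra Gamma (Imp (And a b) a).
Proof. exact (calculus_ipc Gamma (inst3 a b b) _ ipc_andE1). Qed.

Lemma calculus_botE Gamma a : calculus extra Gamma (Imp Bot a).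
Proof. exact (calculus_ipc Gamma (inst3 a a a) _ ipc_botE). Qed.

Lemma calculus_andI Gamma a b :
  calculus extra Gamma a -> calculus extra Gamma b ->
  calculus extra Gamma (And a b).
Proof.
  intros Ha Hb. apply (D_MP _ _ b); [exact Hb|]. apply (D_MP _ _ a); [exact Ha|].
  exact (calculus_ipc Gamma (inst3 a b b) _ ipc_andI).
Qed.

Lemma calculus_weaken Gamma a b :
  calculus extra Gamma b -> calculus extra Gamma (Imp a b).
Proof. intros Hb. exact (D_MP _ _ _ _ Hb (calculus_K _ _ _)). Qed.

Lemma calculus_refl Gamma a : calculus extra Gamma (Imp a a).
Proof.
  apply (D_MP _ _ (Imp a (Imp a a))); [apply calculus_K|].
  apply (D_MP _ _ (Imp a (Imp (Imp a a) a))); [apply calculus_K|].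
  apply calculus_S.
Qed.

Lemma deduction Gamma a b :
  calculus extra (Add _ Gamma a) b -> calculus extra Gamma (Imp a b).
Proof.
  intros H. remember (Add _ Gamma a) as Delta eqn:E.
  induction H as [Delta b Hb | Delta b Hb | Delta b c _ IHb _ IHc
                 | m Delta b c H _]; subst Delta.
  - destruct Hb as [b Hb | b Hb].
    + apply calculus_weaken, D_El, Hb.
    + destruct Hb. apply calculus_refl.
  - apply calculus_weaken, D_Ax, Hb.
  - apply (D_MP _ _ (Imp a b)); [exact (IHb eq_refl)|].
    apply (D_MP _ _ (Imp a (Imp b c))); [exact (IHc eq_refl)|].
    apply calculus_S.
  - apply calculus_weaken, D_Mon, H.
Qed.

End Calculus.

Section Translation.
Context {M N : Type} (f : M -> form N -> form N).

Fixpoint translate (phi : form M) : form N :=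
  match phi with
  | Var i => Var i
  | Bot => Bot
  | And a b => And (translate a) (translate b)
  | Or a b => Or (translate a) (translate b)
  | Imp a b => Imp (translate a) (translate b)
  | Mod m a => f m (translate a)
  end.

(** A translation commuting with the intuitionistic connectives preserves derivability once the
    extra axioms and monotonicity survive it. [Delta] is quantified after the derivation so that the
    induction hypothesis for [D_Mon] can be used at the empty context. *)
Lemma calculus_translate (extraM : Ensemble (form M))
    (extraN : Ensemble (form N)) :
  (forall Delta s a, In _ extraM a ->
     calculus extraN Delta (translate (subst s a))) ->
  (forall m Delta a b, calculus extraN (Empty_set _) (Imp a b) ->
     calculus extraN Delta (Imp (f m a) (f m b))) ->
  forall Gamma phi, calculus extraM Gamma phi ->
  forall Delta,
    (forall a, In _ Gamma a -> calculus extraN Delta (translate a)) ->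
    calculus extraN Delta (translate phi).
Proof.
  intros Hextra Hmon Gamma phi H.
  induction H as [Gamma a Ha | Gamma a Ha | Gamma a b _ IHa _ IHb
                 | m Gamma a b _ IH]; intros Delta HGamma.
  - exact (HGamma a Ha).
  - destruct Ha as (s & c & [c' Hc | c' Hc] & ->).
    (* The intuitionistic axioms are modality-free, so translating an instance under [s] gives the
       instance under [t]. *)
    + pose (t i := translate (s i)).
      destruct Hc.
      * exact (calculus_ipc extraN Delta t _ ipc_K).
      * exact (calculus_ipc extraN Delta t _ ipc_S).
      * exact (calculus_ipc extraN Delta t _ ipc_andI).
      * exact (calculus_ipc extraN Delta t _ ipc_andE1).
      * exact (calculus_ipc extraN Delta t _ ipc_andE2).
      * exact (calculus_ipc extraN Delta t _ ipc_orI1).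
      * exact (calculus_ipc extraN Delta t _ ipc_orI2).
      * exact (calculus_ipc extraN Delta t _ ipc_orE).
      * exact (calculus_ipc extraN Delta t _ ipc_botE).
    + exact (Hextra Delta s c' Hc).
  - exact (D_MP _ _ _ _ (IHa Delta HGamma) (IHb Delta HGamma)).
  - apply Hmon. apply IH. intros c [].
Qed.

End Translation.

Lemma tr_dia_translate phi : tr_dia phi = translate (fun _ => Mod dia) phi.
Proof. induction phi as [| | | | | []]; simpl; congruence. Qed.

(** Only the intuitionistic base and monotonicity of [dia] are used, so [extra] stays arbitrary and
    both WM and IM are covered. *)
Lemma iM_to_calculus extra Gamma phi :
  derives_iM Gamma phi -> calculus extra (set_dia Gamma) (tr_dia phi).
Proof.
  intros H. rewrite tr_dia_translate.
  apply (calculus_translate _ (Empty_set _) extra) with (Gamma := Gamma).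
  - intros Delta s a [].
  - intros _ Delta a b. apply D_Mon.
  - exact H.
  - intros a Ha. rewrite <- tr_dia_translate. apply D_El.
    exact (Im_intro _ _ _ _ _ Ha _ eq_refl).
Qed.

Definition box_to_bot : L_boxdia -> L_tri :=
  translate (fun m a => match m with box => Bot | dia => Mod tri a end).

Lemma box_to_bot_tr_dia phi : box_to_bot (tr_dia phi) = phi.
Proof.
  induction phi as [| | | | | []]; cbn in *; unfold box_to_bot in *; congruence.
Qed.

Lemma WM_to_iM Gamma phi :
  derives_WM (set_dia Gamma) (tr_dia phi) -> derives_iM Gamma phi.
Proof.
  intros H. rewrite <- (box_to_bot_tr_dia phi).
  apply (calculus_translate _ (Singleton _ ax_box_dia_neg) (Empty_set _))
    with (Gamma := set_dia Gamma).
  - intros Delta s a []. apply calculus_andE1.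
  (* Under the reading of [box] as the constant [Bot], monotonicity becomes [Imp Bot Bot]. *)
  - intros [] Delta a b Hab; [apply calculus_refl | apply D_Mon, Hab].
  - exact H.
  - intros _ [a Ha _ ->]. fold (box_to_bot (tr_dia a)).
    rewrite box_to_bot_tr_dia. apply D_El, Ha.
Qed.

Inductive chain3 : Set := lo | mid | hi.

Definition cmin (x y : chain3) : chain3 :=
  match x, y with
  | lo, _ | _, lo => lo
  | mid, _ | _, mid => mid
  | hi, hi => hi
  end.

Definition cmax (x y : chain3) : chain3 :=
  match x, y with
  | hi, _ | _, hi => hi
  | mid, _ | _, mid => mid
  | lo, lo => lo
  end.

(** Heyting implication for [lo] < [mid] < [hi]: the last branch is reached exactly when [x] >
    [y]. *)
Definition cimp (x y : chain3) : chain3 :=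
  match x, y with
  | lo, _ | _, hi | mid, mid => hi
  | _, y => y
  end.

Fixpoint value {M : Type} (phi : form M) : chain3 :=
  match phi with
  | Var _ | Bot => lo
  | And a b => cmin (value a) (value b)
  | Or a b => cmax (value a) (value b)
  | Imp a b => cimp (value a) (value b)
  | Mod _ _ => mid
  end.

(** Since modal formulas all take the value [mid], every conclusion of [D_Mon] evaluates to
    [cimp mid mid], which is [hi]. *)
Lemma value_sound Gamma phi :
  derives_iM Gamma phi -> (forall a, In _ Gamma a -> value a = hi) ->
  value phi = hi.
Proof.
  intros H HGamma.
  induction H as [Gamma a Ha | Gamma a Ha | Gamma a b _ IHa _ IHb | ].
  - exact (HGamma a Ha).
  - destruct Ha as (s & c & [c' Hc | c' []] & ->).
    destruct Hc; simpl; destruct (value (s 0)); try reflexivity;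
      destruct (value (s 1)); try reflexivity;
      destruct (value (s 2)); reflexivity.
  - specialize (IHa HGamma). specialize (IHb HGamma). simpl in IHb.
    rewrite IHa in IHb. destruct (value b); [exact IHb..].
  - reflexivity.
Qed.

Lemma IM_dia_bot_stable Gamma :
  In _ Gamma (Neg (Neg (Mod dia Bot))) -> derives_IM Gamma (Mod dia Bot).
Proof.
  intros HGamma.
  apply (D_MP _ _ (Imp (Mod box Top) (Mod dia Bot))).
  (* Under [Mod box Top], it suffices to refute [Mod dia Bot], contradicting the hypothesis in
     [Gamma]. *)
  - apply deduction. apply (D_MP _ _ Bot); [|apply calculus_botE].
    apply (D_MP _ _ (Neg (Mod dia Bot))); [|apply D_El; left; exact HGamma].
    apply deduction.
    apply (D_MP _ _ (And (Mod box Top) (Mod dia (Neg Top)))).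
    + apply calculus_andI.
      * apply D_El. left. right. constructor.
      (* [Mod dia Bot] is lifted along [Imp Bot (Neg Top)] to meet the first axiom at p := [Top]. *)
      * apply (D_MP _ _ (Mod dia Bot)); [apply D_El; right; constructor|].
        apply D_Mon, calculus_botE.
    + exact (calculus_extra _ _ (fun _ => Top) _ (Couple_l _ _ _)).
  - exact (calculus_extra _ _ (fun _ => Bot) _ (Couple_r _ _ _)).
Qed.

Theorem theorem4p11 :
  (forall (Gamma : Ensemble L_tri) (phi : L_tri),
     derives_iM Gamma phi <-> derives_WM (set_dia Gamma) (tr_dia phi)) /\
  (forall (Gamma : Ensemble L_tri) (phi : L_tri),
     derives_iM Gamma phi -> derives_IM (set_dia Gamma) (tr_dia phi)) /\
  (exists (Gamma : Ensemble L_tri) (phi : L_tri),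
     derives_IM (set_dia Gamma) (tr_dia phi) /\ ~ derives_iM Gamma phi).
Proof.
  split; [|split].
  - intros Gamma phi. split; [apply iM_to_calculus | apply WM_to_iM].
  - intros Gamma phi. apply iM_to_calculus.
  - exists (Singleton _ (Neg (Neg (Mod tri Bot)))), (Mod tri Bot). split.
    + apply IM_dia_bot_stable.
      exact (Im_intro _ _ _ _ _ (In_singleton _ _) _ eq_refl).
    (* In the chain [Neg] sends [mid] to [lo] and [lo] to [hi], so the premise has value [hi] while
       [Mod tri Bot] has value [mid]. *)
    + intros H. apply value_sound in H; [discriminate H|].
      intros a []. reflexivity.
Qed.
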